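(* (a) The index set $UHI=\{e:\mathcal{A}_e\text{ is an ultrahomogeneous injection structure}\}$ is $\Pi^0_2$ complete, and in fact $\Pi^0_2$ complete relative to $INJ$. (b) The index set $WUI=\{e:\mathcal{A}_e\text{ is a weakly ultrahomogeneous injection structure}\}$ is $\Sigma^0_3$ complete, and in fact $\Sigma^0_3$ complete relative to $INJ$.
   Context: $\{\varphi_e\}_{e\in\omega}$ is the standard enumeration of the partial computable functions. An injection structure is a set with a single one-to-one unary function. $\mathcal{A}_e=(\omega,\varphi_e)$ is defined when $\varphi_e$ is total and is an injection; $INJ=\{e:\mathcal{A}_e\text{ is an injection structure}\}$. An injection structure is ultrahomogeneous if every isomorphism between finitely generated substructures extends to an automorphism; it is weakly ultrahomogeneous if there is a finite set $\{a_1,\dots,a_n\}$ of elements such that the expansion by constants naming $a_1,\dots,a_n$ is ultrahomogeneous (equivalently, every isomorphism between finitely generated substructures containing all $a_i$ and fixing each $a_i$ extends to an automorphism). For a class $\Gamma$ (such as $\Pi^0_2$ or $\Sigma^0_3$), a set $B\subseteq\omega$ is $\Gamma$ complete if $B\in\Gamma$ and for every $A\in\Gamma$ there is a computable $f$ with $i\in A\iff f(i)\in B$ for all $i$. For $B\subseteq C\subseteq\omega$, $B$ is $\Gamma$ complete relative to $C$ if $B=C\cap R$ for some $R\in\Gamma$ and for every $A\in\Gamma$ there is a computable $f$ with $f(i)\in C$ for all $i$ and $i\in A\iff f(i)\in B$ for all $i$. *)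

(* Defs.v *)
From Stdlib Require Import Arith Lia List.
From Stdlib Require Import Cantor FinFun.
Import ListNotations.

(* Partial computable functions: the unary functions on [nat] obtained from
   zero, successor and the two projections of Cantor's pairing by pairing,
   composition, primitive recursion and minimization.  Functions of several
   arguments are represented through [Cantor.to_nat]. *)

Inductive code : Type :=
| Zero : code
| Succ : code
| Fst : code
| Snd : code
| Pair : code -> code -> code
| Comp : code -> code -> code
| Prec : code -> code -> code
| Mu : code -> code.

(* h(a,0) = g(a),  h(a,n+1) = k(a,(n,h(a,n))),  for partial g and k given by
   their graphs. *)
Fixpoint primrec (g k : nat -> nat -> Prop) (a n y : nat) : Prop :=
  match n with
  | 0 => g a y
  | S m => exists u, primrec g k a m u /\
                     k (Cantor.to_nat (a, Cantor.to_nat (m, u))) y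
  end.

(* [eval c x y]: the partial function with code [c] is defined at [x] with
   value [y].  In the [Mu] case all smaller candidates must give a defined,
   nonzero value. *)
Fixpoint eval (c : code) : nat -> nat -> Prop :=
  match c with
  | Zero => fun _ y => y = 0
  | Succ => fun x y => y = S x
  | Fst => fun x y => y = fst (Cantor.of_nat x)
  | Snd => fun x y => y = snd (Cantor.of_nat x)
  | Pair c d => fun x y =>
      exists u v, eval c x u /\ eval d x v /\ y = Cantor.to_nat (u, v)
  | Comp c d => fun x y => exists u, eval d x u /\ eval c u y
  | Prec c d => fun x y =>
      primrec (eval c) (eval d)
        (fst (Cantor.of_nat x)) (snd (Cantor.of_nat x)) y
  | Mu c => fun x y =>
      eval c (Cantor.to_nat (x, y)) 0 /\
      forall z, z < y -> exists v, eval c (Cantor.to_nat (x, z)) (S v)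
  end.

Lemma primrec_functional (g k : nat -> nat -> Prop) :
  (forall x y z, g x y -> g x z -> y = z) ->
  (forall x y z, k x y -> k x z -> y = z) ->
  forall a n y z, primrec g k a n y -> primrec g k a n z -> y = z.
Proof.
  intros Hg Hk a n; induction n as [|n IH]; simpl; intros y z.
  - apply Hg.
  - intros (u & Hu & Hy) (v & Hv & Hz).
    rewrite (IH _ _ Hu Hv) in Hy. exact (Hk _ _ _ Hy Hz).
Qed.

Lemma eval_functional (c : code) (x y z : nat) :
  eval c x y -> eval c x z -> y = z.
Proof.
  revert x y z.
  induction c as [ | | | |c IHc d IHd|c IHc d IHd|c IHc d IHd|c IHc];
    simpl; intros x y z; try congruence.
  - intros (u & v & Hu & Hv & ->) (u' & v' & Hu' & Hv' & ->).
    now rewrite (IHc _ _ _ Hu Hu'), (IHd _ _ _ Hv Hv').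
  - intros (u & Hu & Hy) (u' & Hu' & Hz).
    rewrite (IHd _ _ _ Hu Hu') in Hy. exact (IHc _ _ _ Hy Hz).
  - apply primrec_functional; assumption.
  - intros (Hy & Hy') (Hz & Hz').
    destruct (Nat.lt_trichotomy y z) as [H | [H | H]]; [ | exact H | ].
    + destruct (Hz' _ H) as (v & Hv). discriminate (IHc _ _ _ Hy Hv).
    + destruct (Hy' _ H) as (v & Hv). discriminate (IHc _ _ _ Hz Hv).
Qed.

(* Goedel numbering, a bijection between codes and natural numbers. *)
Fixpoint encode (c : code) : nat :=
  match c with
  | Zero => 0
  | Succ => 1
  | Fst => 2
  | Snd => 3
  | Pair c d => 4 + 4 * Cantor.to_nat (encode c, encode d)
  | Comp c d => 5 + 4 * Cantor.to_nat (encode c, encode d)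
  | Prec c d => 6 + 4 * Cantor.to_nat (encode c, encode d)
  | Mu c => 7 + 4 * encode c
  end.

Lemma encode_inj (c d : code) : encode c = encode d -> c = d.
Proof.
  revert d.
  induction c as [ | | | |c1 IH1 c2 IH2|c1 IH1 c2 IH2|c1 IH1 c2 IH2|c1 IH1];
    intros [ | | | |d1 d2|d1 d2|d1 d2|d1]; cbn [encode]; intros H;
    try reflexivity; try (exfalso; lia).
  1-3: assert (E : Cantor.to_nat (encode c1, encode c2) =
                   Cantor.to_nat (encode d1, encode d2)) by lia;
       apply Cantor.to_nat_inj in E; injection E as E1 E2;
       now rewrite (IH1 _ E1), (IH2 _ E2).
  rewrite (IH1 d1); [reflexivity | lia].
Qed.

Lemma encode_surj (e : nat) : exists c, encode c = e.
Proof.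
  induction e as [e IH] using lt_wf_ind.
  destruct (le_lt_dec 4 e) as [He | He].
  - assert (Hdm : e - 4 = 4 * ((e - 4) / 4) + (e - 4) mod 4)
      by (apply Nat.div_mod_eq).
    assert (Hr : (e - 4) mod 4 < 4) by (apply Nat.mod_upper_bound; lia).
    set (q := (e - 4) / 4) in *. set (r := (e - 4) mod 4) in *.
    assert (Hp : exists c d, Cantor.to_nat (encode c, encode d) = q).
    { pose proof (Cantor.cancel_to_of q) as Hq.
      destruct (Cantor.of_nat q) as [a b].
      pose proof (Cantor.to_nat_non_decreasing a b) as Hab.
      destruct (IH a) as [c Hc]; [lia|]. destruct (IH b) as [d Hd]; [lia|].
      exists c, d. now rewrite Hc, Hd. }
    destruct Hp as (c & d & Hcd).
    assert (r = 0 \/ r = 1 \/ r = 2 \/ r = 3) as [E | [E | [E | E]]] by lia.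
    + exists (Pair c d). cbn [encode]. lia.
    + exists (Comp c d). cbn [encode]. lia.
    + exists (Prec c d). cbn [encode]. lia.
    + destruct (IH q) as [c' Hc']; [lia|].
      exists (Mu c'). cbn [encode]. lia.
  - assert (e = 0 \/ e = 1 \/ e = 2 \/ e = 3) as [E | [E | [E | E]]] by lia;
      subst e; [exists Zero | exists Succ | exists Fst | exists Snd];
      reflexivity.
Qed.

(* The graph of the [e]-th partial computable function. *)
Definition phi (e x y : nat) : Prop := exists c, encode c = e /\ eval c x y.

Definition computable (f : nat -> nat) : Prop :=
  exists e, forall x, phi e x (f x).

Definition computable_set (A : nat -> Prop) : Prop :=
  exists chi, computable chi /\
    forall n, (A n /\ chi n = 1) \/ (~ A n /\ chi n = 0).

(* The arithmetical hierarchy; [Sigma0 k] and [Pi0 k] are the classes of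
   Sigma^0_k and Pi^0_k subsets of [nat]. *)
Fixpoint Sigma0 (k : nat) (A : nat -> Prop) : Prop :=
  match k with
  | 0 => computable_set A
  | S j => exists B, Pi0 j B /\
             forall n, A n <-> exists x, B (Cantor.to_nat (n, x))
  end
with Pi0 (k : nat) (A : nat -> Prop) : Prop :=
  match k with
  | 0 => computable_set A
  | S j => exists B, Sigma0 j B /\
             forall n, A n <-> forall x, B (Cantor.to_nat (n, x))
  end.

Definition complete (Gamma : (nat -> Prop) -> Prop) (B : nat -> Prop) : Prop :=
  Gamma B /\
  forall A, Gamma A ->
    exists f, computable f /\ forall i, A i <-> B (f i).

Definition complete_relative (Gamma : (nat -> Prop) -> Prop)
    (B C : nat -> Prop) : Prop :=
  (exists R, Gamma R /\ forall n, B n <-> C n /\ R n) /\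
  forall A, Gamma A ->
    exists f, computable f /\ (forall i, C (f i)) /\
      forall i, A i <-> B (f i).

(* Structures [(A, f, c)_{c in cs}] with one unary function and finitely many
   named elements. *)

(* Universe of the substructure generated by the elements of [l]; it always
   contains the named elements.  It is closed under [f] only, not under the
   inverse of [f]. *)
Inductive generated {A : Type} (f : A -> A) (cs l : list A) : A -> Prop :=
| generated_const : forall c, In c cs -> generated f cs l c
| generated_gen : forall a, In a l -> generated f cs l a
| generated_step : forall x, generated f cs l x -> generated f cs l (f x).

Definition fg_substructure {A : Type} (f : A -> A) (cs : list A)
    (S : A -> Prop) : Prop :=
  exists l, forall x, S x <-> generated f cs l x.

(* [p] restricts to an isomorphism from the substructure [S] onto the
   substructure [T]; the values of [p] outside [S] are irrelevant. *)
Record isomorphism {A : Type} (f : A -> A) (cs : list A) (S T : A -> Prop)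
    (p : A -> A) : Prop := {
  iso_maps : forall x, S x -> T (p x);
  iso_inj : forall x y, S x -> S y -> p x = p y -> x = y;
  iso_surj : forall y, T y -> exists x, S x /\ p x = y;
  iso_fun : forall x, S x -> p (f x) = f (p x);
  iso_const : forall c, In c cs -> p c = c
}.

Definition automorphism {A : Type} (f : A -> A) (cs : list A) (g : A -> A)
    : Prop :=
  isomorphism f cs (fun _ => True) (fun _ => True) g.

Definition ultrahomogeneous_expansion {A : Type} (f : A -> A) (cs : list A)
    : Prop :=
  forall (S T : A -> Prop) (p : A -> A),
    fg_substructure f cs S -> fg_substructure f cs T ->
    isomorphism f cs S T p ->
    exists g, automorphism f cs g /\ forall x, S x -> g x = p x.

Definition ultrahomogeneous {A : Type} (f : A -> A) : Prop :=
  ultrahomogeneous_expansion f [].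

Definition weakly_ultrahomogeneous {A : Type} (f : A -> A) : Prop :=
  exists cs : list A, ultrahomogeneous_expansion f cs.

(* [phi e] is total with graph [f], and [(nat, f)] is an injection
   structure. *)
Definition injection_structure (e : nat) (f : nat -> nat) : Prop :=
  (forall x, phi e x (f x)) /\ Injective f.

Definition INJ (e : nat) : Prop := exists f, injection_structure e f.

Definition UHI (e : nat) : Prop :=
  exists f, injection_structure e f /\ ultrahomogeneous f.

Definition WUI (e : nat) : Prop :=
  exists f, injection_structure e f /\ weakly_ultrahomogeneous f.

(* Main.v *)
Require Import Defs.
From Stdlib Require Import Arith Lia List Cantor FinFun ClassicalEpsilon.
Import ListNotations.

(** An injection structure is a disjoint union of finite cycles, copies of the
    integers and copies of the natural numbers; the last kind of orbit starts
    at an element without predecessor.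

    Semantics.  Such a starting element [x], if its orbit contains no named
    element, refutes ultrahomogeneity: the substructures generated by [x] and
    by [f x] are isomorphic, but no automorphism takes [x] to [f x]
    ([uh_orbit_start]).  If every starting element is named, then [f] is
    invertible wherever an isomorphism of finitely generated substructures is
    not already forced to be the identity.  The isomorphism therefore extends
    to the union of the full orbits it meets, and, these orbits being finite
    in number, the complements of its new domain and range can be matched up
    ([uh_of_starts_named]).  Hence ultrahomogeneous means onto, and weakly
    ultrahomogeneous means onto up to finitely many elements.

    Upper bounds.  A stack machine whose single step is defined by cases
    simulates the codes, which makes [phi e x y] the projection of a decidable
    relation ([phi_iff]).  Being a total injection whose range contains all
    [y >= N] is then a [forall exists] statement about [e] and [N]
    ([INJ_onto_from_iff]); taking [N = 0], or prefixing [exists N], gives the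
    two classes.

    Hardness.  Let [e : nat -> nat] be any sequence, and at stage [s] remove
    from [nat] the element of rank [e s] among those still present.  The
    removed elements form an injection [discard e], total by construction,
    and the element of rank [p] is eventually safe exactly when [e s > p] for
    almost all [s].  So [discard e] is onto iff [0] occurs infinitely often
    in [e], and its range is cofinite iff some number does.  A Pi^0_2 statement
    says that a decidable event happens infinitely often
    ([Pi02_recurrent]), and a Sigma^0_3 statement says that one of countably
    many such events does; both are thus read off a computable sequence, and
    [discard_reduction] yields both reductions, always into [INJ]. *)

(** * Ultrahomogeneity of injection structures *)

Lemma iter_injective {A : Type} (f : A -> A) (n : nat) :
  Injective f -> Injective (Nat.iter n f).
Proof.
  intros Hf x y; induction n as [|n IH]; simpl; auto.
Qed.

Lemma generated_iff {A : Type} (f : A -> A) (cs l : list A) (x : A) :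
  generated f cs l x <-> exists a n, In a (cs ++ l) /\ x = Nat.iter n f a.
Proof.
  split.
  - induction 1 as [c Hc|a Ha|x _ (a & n & Ha & ->)].
    + exists c, 0. split; [apply in_or_app; auto | reflexivity].
    + exists a, 0. split; [apply in_or_app; auto | reflexivity].
    + exists a, (S n). split; [exact Ha | reflexivity].
  - intros (a & n & Ha & ->). induction n as [|n IH]; simpl.
    + apply in_app_or in Ha as [Ha|Ha]; now constructor.
    + now constructor.
Qed.

(** If the orbit of [x] starts at [x] and avoids the named elements, then
    shifting that orbit by one step is an isomorphism of [x]'s substructure
    onto that of [f x]; an automorphism extending it would need a
    predecessor of [x]. *)
Lemma uh_orbit_start {A : Type} (f : A -> A) (cs : list A) :
  Injective f -> ultrahomogeneous_expansion f cs ->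
  forall x, (forall y, f y <> x) -> exists n, In (Nat.iter n f x) cs.
Proof.
  intros Hf Huh x Hx. apply NNPP. intros Hcs.
  set (orbit := fun z => exists n, z = Nat.iter n f x).
  assert (Horb : forall c n, In c cs -> ~ orbit (Nat.iter n f c)).
  { intros c n Hc (m & Hm). revert m Hm.
    induction n as [|n IH]; intros [|m] Hm; simpl in Hm.
    - apply Hcs. exists 0. now rewrite Hm in Hc.
    - apply Hcs. exists (S m). now rewrite Hm in Hc.
    - exact (Hx _ Hm).
    - exact (IH m (Hf _ _ Hm)). }
  set (p := fun z => if excluded_middle_informative (orbit z) then f z else z).
  assert (Hin : forall z, orbit z -> p z = f z).
  { intros z Hz. unfold p. now destruct excluded_middle_informative. }
  assert (Hout : forall z, ~ orbit z -> p z = z).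
  { intros z Hz. unfold p. now destruct excluded_middle_informative. }
  assert (HinS : forall z, orbit z -> orbit (f z)).
  { intros z (n & ->). now exists (S n). }
  assert (HS : forall z, generated f cs [x] z <->
                         orbit z \/ exists c n, In c cs /\ z = Nat.iter n f c).
  { intros z. rewrite generated_iff. split.
    - intros (a & n & Ha & ->). apply in_app_or in Ha as [Ha|[<-|[]]].
      + right. eauto.
      + left. now exists n.
    - intros [(n & ->)|(c & n & Hc & ->)].
      + exists x, n. split; [apply in_or_app; simpl; auto | reflexivity].
      + exists c, n. split; [apply in_or_app; auto | reflexivity]. }
  assert (HT : forall z, generated f cs [f x] z <->
                 (exists w, orbit w /\ z = f w) \/
                 exists c n, In c cs /\ z = Nat.iter n f c).
  { intros z. rewrite generated_iff. split.
    - intros (a & n & Ha & ->). apply in_app_or in Ha as [Ha|[<-|[]]].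
      + right. eauto.
      + left. exists (Nat.iter n f x). split; [now exists n|].
        now rewrite <- Nat.iter_succ_r.
    - intros [(w & (n & ->) & ->)|(c & n & Hc & ->)].
      + exists (f x), n. split; [apply in_or_app; simpl; auto |].
        now rewrite <- Nat.iter_succ_r.
      + exists c, n. split; [apply in_or_app; auto | reflexivity]. }
  destruct (Huh (generated f cs [x]) (generated f cs [f x]) p)
    as (g & [_ Hinj Hsurj Hfun _] & Hg).
  - now exists [x].
  - now exists [f x].
  - split.
    + intros z. rewrite HS, HT. intros [Hz|(c & n & Hc & ->)].
      * left. exists z. auto.
      * right. exists c, n. auto.
    + intros y z. rewrite !HS.
      intros [Hy|(c & n & Hc & ->)] [Hz|(d & m & Hd & ->)];
        rewrite ?(Hin _ Hy), ?(Hin _ Hz), ?Hout by auto; auto.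
      * intros E. apply HinS in Hy. rewrite E in Hy. now apply Horb in Hy.
      * intros E. apply HinS in Hz. rewrite <- E in Hz. now apply Horb in Hz.
    + intros y. rewrite HT. intros [(w & Hw & ->)|(c & n & Hc & ->)].
      * exists w. rewrite HS. auto.
      * exists (Nat.iter n f c). rewrite HS. split; [right; eauto | auto].
    + intros z. rewrite HS. intros [Hz|(c & n & Hc & ->)].
      * now rewrite !Hin by auto.
      * rewrite (Hout (Nat.iter n f c)) by auto. now apply Hout, (Horb c (S n)).
    + intros c Hc. now apply Hout, (Horb c 0).
  - destruct (Hsurj x I) as (b & _ & Hb).
    apply (Hx b), Hinj; auto. rewrite Hfun, Hb, Hg, Hin; auto.
    + now exists 0.
    + rewrite HS. left. now exists 0.
Qed.

Fixpoint rel_iter {A : Type} (P : A -> A -> Prop) (n : nat) (x y : A) : Prop :=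
  match n with
  | 0 => x = y
  | S m => exists z, P x z /\ rel_iter P m z y
  end.

Lemma rel_iter_add {A : Type} (P : A -> A -> Prop) (m n : nat) (x y : A) :
  rel_iter P (m + n) x y <-> exists z, rel_iter P m x z /\ rel_iter P n z y.
Proof.
  revert x; induction m as [|m IH]; intros x; simpl.
  - split; [eauto | now intros (z & -> & H)].
  - split.
    + intros (z & Hz & (w & Hw & Hy)%IH). eauto.
    + intros (w & (z & Hz & Hw) & Hy). exists z. rewrite IH. eauto.
Qed.

Lemma rel_iter_converse {A : Type} (P : A -> A -> Prop) (n : nat) (x y : A) :
  rel_iter (fun u v => P v u) n x y <-> rel_iter P n y x.
Proof.
  revert x; induction n as [|n IH]; intros x; [simpl; split; congruence|].
  replace (rel_iter P (S n) y x) with (rel_iter P (n + 1) y x)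
    by (f_equal; lia).
  rewrite rel_iter_add. simpl. split.
  - intros (z & Hz & Hy%IH). eauto.
  - intros (z & Hz & (w & Hw & ->)). exists z. rewrite IH. auto.
Qed.

(** The graph [P] of an isomorphism between two sets containing [cs] and
    meeting finitely many orbits; [pi_comm] asks [P] to reflect [f] and not
    just to preserve it, as [P] is meant to cover full orbits.  The
    notion is invariant under taking the converse of [P], which halves the
    work below. *)
Record partial_iso {A : Type} (f : A -> A) (cs : list A) (P : A -> A -> Prop)
    : Prop := {
  pi_fun : forall x y z, P x y -> P x z -> y = z;
  pi_inj : forall x y z, P x z -> P y z -> x = y;
  pi_comm : forall x y, P (f x) (f y) <-> P x y;
  pi_const : forall c, In c cs -> P c c;
  pi_dom_fin : exists l, forall x y, P x y ->
    exists a m n, In a l /\ Nat.iter m f x = Nat.iter n f a;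
  pi_ran_fin : exists l, forall x y, P x y ->
    exists a m n, In a l /\ Nat.iter m f y = Nat.iter n f a
}.

Lemma partial_iso_converse {A : Type} (f : A -> A) cs P :
  @partial_iso A f cs P -> partial_iso f cs (fun x y => P y x).
Proof.
  intros [H1 H2 H3 H4 (l & H5) (l' & H6)]. split; eauto.
Qed.

Lemma pigeonhole {A : Type} (l : list A) (Q : nat -> A -> Prop) :
  (forall k, exists a, In a l /\ Q k a) ->
  exists i j a, i < j /\ Q i a /\ Q j a.
Proof.
  intros H.
  set (c := fun k => proj1_sig (constructive_indefinite_description _ (H k))).
  assert (Hc : forall k, In (c k) l /\ Q k (c k)).
  { intros k. unfold c. apply proj2_sig. }
  assert (Hni : ~ Injective c).
  { intros Hinj.
    assert (Hlen : length (map c (seq 0 (S (length l)))) <= length l).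
    { apply NoDup_incl_length.
      - apply Injective_map_NoDup; [exact Hinj | apply seq_NoDup].
      - intros a Ha. apply in_map_iff in Ha as (k & <- & _). apply Hc. }
    rewrite length_map, length_seq in Hlen. lia. }
  apply NNPP. intros Hno. apply Hni. intros i j E.
  destruct (Nat.lt_trichotomy i j) as [L|[L|L]]; auto; exfalso; apply Hno.
  - exists i, j, (c i). split; [exact L|]. split; [apply Hc|].
    rewrite E. apply Hc.
  - exists j, i, (c j). split; [exact L|]. split; [apply Hc|].
    rewrite <- E. apply Hc.
Qed.

Section Extension.
Context {A : Type} (f : A -> A) (cs : list A).
Context (f_inj : Injective f).
Context (starts_named : forall x, (forall y, f y <> x) -> In x cs).

Lemma pi_comm_iter P n x y :
  partial_iso f cs P -> P (Nat.iter n f x) (Nat.iter n f y) <-> P x y.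
Proof.
  intros HP; induction n as [|n IH]; simpl; [reflexivity|].
  now rewrite (pi_comm _ _ _ HP).
Qed.

(** The domain is closed under predecessors: an image without predecessor
    would be named, hence fixed, hence equal to its preimage. *)
Lemma pi_dom_pred P x z :
  partial_iso f cs P -> P (f x) z -> exists y, P x y.
Proof.
  intros HP Hz.
  destruct (classic (exists y, f y = z)) as [(y & <-)|Hno].
  - exists y. now apply (pi_comm _ _ _ HP).
  - exfalso. apply Hno. exists x.
    apply (pi_inj _ _ _ HP _ _ z Hz), (pi_const _ _ _ HP), starts_named.
    eauto.
Qed.

Lemma pi_dom_iter P n x z :
  partial_iso f cs P -> P (Nat.iter n f x) z -> exists y, P x y.
Proof.
  intros HP; revert x z; induction n as [|n IH]; intros x z Hz; [eauto|].
  rewrite Nat.iter_succ_r in Hz. destruct (IH _ _ Hz) as (y & Hy).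
  exact (pi_dom_pred _ _ _ HP Hy).
Qed.

Lemma rel_iter_fun P n x y z :
  partial_iso f cs P -> rel_iter P n x y -> rel_iter P n x z -> y = z.
Proof.
  intros HP; revert x; induction n as [|n IH]; intros x; simpl; [congruence|].
  intros (u & Hu & Hy) (v & Hv & Hz).
  rewrite (pi_fun _ _ _ HP _ _ _ Hu Hv) in Hy. eauto.
Qed.

Lemma rel_iter_comm P n x y m :
  partial_iso f cs P -> rel_iter P n x y ->
  rel_iter P n (Nat.iter m f x) (Nat.iter m f y).
Proof.
  intros HP; revert x; induction n as [|n IH]; intros x; simpl; [congruence|].
  intros (u & Hu & Hy). exists (Nat.iter m f u).
  now rewrite (pi_comm_iter _ _ _ _ HP); auto.
Qed.

(** Following [P] backwards from a point outside its domain cannot revisit an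
    orbit, since going forwards again would put that point in the domain after
    all; there being finitely many orbits
    in its range, the walk leaves that range. *)
Lemma backward_walk_ends P x :
  partial_iso f cs P -> (forall y, ~ P x y) ->
  exists k y, rel_iter P k y x /\ forall z, ~ P z y.
Proof.
  intros HP Hx. apply NNPP. intros Hno.
  assert (Hwalk : forall k, exists y, rel_iter P k y x).
  { induction k as [|k (y & Hy)]; [now exists x|].
    apply NNPP. intros Hk. apply Hno. exists k, y. split; [exact Hy|].
    intros z Hz. apply Hk. exists z. simpl. eauto. }
  destruct (pi_ran_fin _ _ _ HP) as (l & Hl).
  destruct (pigeonhole l (fun k a => exists y m n, rel_iter P k y x /\
              Nat.iter m f y = Nat.iter n f a))
    as (i & j & a & Hij & (y & m & n & Hy & Em) & (y' & m' & n' & Hy' & Em')).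
  { intros k. destruct (Hwalk k) as (y & Hy).
    assert (exists z, P z y) as (z & Hz).
    { apply NNPP. intros Hk. apply Hno. exists k, y. split; [exact Hy|].
      intros z Hz. eauto. }
    destruct (Hl _ _ Hz) as (a & m & n & Ha & E). exists a. split; eauto. }
  (* The walk meets the orbit of [a] at times [i < j]; going forwards from
     that orbit, [x]'s orbit is reached after [i] steps and again later. *)
  assert (E : Nat.iter (n' + m) f y = Nat.iter (n + m') f y').
  { rewrite !Nat.iter_add, Em, Em', <- !Nat.iter_add. f_equal. lia. }
  apply (rel_iter_comm _ _ _ _ (n' + m) HP) in Hy.
  apply (rel_iter_comm _ _ _ _ (n + m') HP) in Hy'.
  rewrite <- E in Hy'. replace j with (i + S (j - i - 1)) in Hy' by lia.
  apply rel_iter_add in Hy' as (w & Hw & (v & Hv & _)).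
  rewrite (rel_iter_fun _ _ _ _ _ HP Hw Hy) in Hv.
  destruct (pi_dom_iter _ _ _ _ HP Hv) as (u & Hu). exact (Hx _ Hu).
Qed.

(** The total extension of [P]: a point outside the domain goes to the end of
    its backward walk, so [P]-chains are closed up into cycles. *)
Definition closing (P : A -> A -> Prop) (x y : A) : Prop :=
  P x y \/
  ((forall z, ~ P x z) /\ (forall z, ~ P z y) /\ exists k, rel_iter P k y x).

Lemma closing_converse P x y :
  closing (fun u v => P v u) x y <-> closing P y x.
Proof.
  unfold closing. split.
  - intros [H|(H1 & H2 & k & Hk)]; [now left | right].
    apply rel_iter_converse in Hk. eauto.
  - intros [H|(H1 & H2 & k & Hk)]; [now left | right].
    repeat split; auto. exists k. now apply rel_iter_converse.
Qed.

Lemma closing_total P x : partial_iso f cs P -> exists y, closing P x y.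
Proof.
  intros HP. destruct (classic (exists y, P x y)) as [(y & Hy)|Hno].
  - exists y. now left.
  - assert (Hx : forall y, ~ P x y) by eauto.
    destruct (backward_walk_ends P x HP Hx) as (k & y & Hk & Hy).
    exists y. right. eauto.
Qed.

Lemma closing_inj P x y z :
  partial_iso f cs P -> closing P x z -> closing P y z -> x = y.
Proof.
  intros HP [Hx|(Hx & Hz & i & Hi)] [Hy|(Hy & Hz' & j & Hj)].
  - exact (pi_inj _ _ _ HP _ _ _ Hx Hy).
  - now apply Hz' in Hx.
  - now apply Hz in Hy.
  - destruct (Nat.lt_trichotomy i j) as [L|[L|L]].
    + exfalso. replace j with (i + S (j - i - 1)) in Hj by lia.
      apply rel_iter_add in Hj as (w & Hw & (v & Hv & _)).
      rewrite (rel_iter_fun _ _ _ _ _ HP Hw Hi) in Hv. exact (Hx _ Hv).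
    + subst j. exact (rel_iter_fun _ _ _ _ _ HP Hi Hj).
    + exfalso. replace i with (j + S (i - j - 1)) in Hi by lia.
      apply rel_iter_add in Hi as (w & Hw & (v & Hv & _)).
      rewrite (rel_iter_fun _ _ _ _ _ HP Hw Hj) in Hv. exact (Hy _ Hv).
Qed.

Lemma closing_comm P x y :
  partial_iso f cs P -> closing P x y -> closing P (f x) (f y).
Proof.
  intros HP [H|(Hx & Hy & k & Hk)].
  - left. now apply (pi_comm _ _ _ HP).
  - right. split; [|split].
    + intros z Hz. destruct (pi_dom_pred _ _ _ HP Hz) as (u & Hu).
      exact (Hx _ Hu).
    + intros z Hz.
      destruct (pi_dom_pred _ _ _ (partial_iso_converse _ _ _ HP) Hz)
        as (u & Hu).
      exact (Hy _ Hu).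
    + exists k. exact (rel_iter_comm _ _ _ _ 1 HP Hk).
Qed.

Lemma partial_iso_extends P :
  partial_iso f cs P ->
  exists g, automorphism f cs g /\ forall x y, P x y -> g x = y.
Proof.
  intros HP. pose proof (partial_iso_converse _ _ _ HP) as HP'.
  assert (Hfun : forall x y z, closing P x y -> closing P x z -> y = z).
  { intros x y z Hy Hz. apply (closing_inj _ _ _ x HP'); now apply closing_converse. }
  set (g := fun x => proj1_sig
         (constructive_indefinite_description _ (closing_total P x HP))).
  assert (Hg : forall x, closing P x (g x)).
  { intros x. unfold g. apply proj2_sig. }
  exists g. split; [split|]; auto.
  - intros x y _ _ E. pose proof (Hg x) as Hx. rewrite E in Hx.
    exact (closing_inj _ _ _ _ HP Hx (Hg y)).
  - intros y _. destruct (closing_total _ y HP') as (x & Hx).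
    exists x. split; [exact I|]. apply (Hfun x); [apply Hg|].
    now apply closing_converse.
  - intros x _. apply (Hfun (f x)); [apply Hg|].
    now apply closing_comm.
  - intros c Hc. apply (Hfun c); [apply Hg|]. left.
    now apply (pi_const _ _ _ HP).
  - intros x y H. apply (Hfun x); [apply Hg | now left].
Qed.

(** An isomorphism of finitely generated substructures extends to their
    closures under predecessors by cancelling iterates of [f]. *)
Lemma uh_of_starts_named : ultrahomogeneous_expansion f cs.
Proof.
  intros S T p (lS & HS) (lT & HT) [Hmaps Hinj Hsurj Hfun Hconst].
  set (P := fun x y => exists n,
         S (Nat.iter n f x) /\ p (Nat.iter n f x) = Nat.iter n f y).
  assert (HSf : forall n x, S x -> S (Nat.iter n f x)).
  { intros n x Hx; induction n as [|n IH]; simpl; [exact Hx|].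
    rewrite HS in *. now constructor. }
  assert (Hpf : forall n x, S x -> p (Nat.iter n f x) = Nat.iter n f (p x)).
  { intros n x Hx; induction n as [|n IH]; simpl; [reflexivity|].
    rewrite Hfun by auto. now rewrite IH. }
  (* Two instances of [P] are witnessed by a common iterate. *)
  assert (Hlift : forall x y n m, S (Nat.iter n f x) ->
            p (Nat.iter n f x) = Nat.iter n f y ->
            S (Nat.iter (m + n) f x) /\
            p (Nat.iter (m + n) f x) = Nat.iter (m + n) f y).
  { intros x y n m Hx E. rewrite !Nat.iter_add. split; [now apply HSf|].
    rewrite Hpf by auto. now rewrite E. }
  destruct (partial_iso_extends P) as (g & Hg & HgP).
  - split.
    + intros x y z (n & Hn & En) (m & Hm & Em).
      destruct (Hlift _ _ _ m Hn En) as [_ E1].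
      destruct (Hlift _ _ _ n Hm Em) as [_ E2].
      rewrite (Nat.add_comm n m) in E2. rewrite E1 in E2.
      exact (iter_injective f _ f_inj _ _ E2).
    + intros x y z (n & Hn & En) (m & Hm & Em).
      destruct (Hlift _ _ _ m Hn En) as [S1 E1].
      destruct (Hlift _ _ _ n Hm Em) as [S2 E2].
      rewrite (Nat.add_comm n m) in S2, E2. rewrite <- E2 in E1.
      exact (iter_injective f _ f_inj _ _ (Hinj _ _ S1 S2 E1)).
    + intros x y. split; intros (n & Hn & En).
      * exists (Datatypes.S n). now rewrite !Nat.iter_succ_r.
      * exists n. rewrite <- !Nat.iter_succ_r.
        exact (Hlift _ _ _ 1 Hn En).
    + intros c Hc. exists 0. split; [|exact (Hconst c Hc)].
      apply HS. now constructor.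
    + exists (cs ++ lS). intros x y (n & Hn & _).
      apply HS, generated_iff in Hn as (a & m & Ha & E). eauto.
    + exists (cs ++ lT). intros x y (n & Hn & En).
      apply Hmaps in Hn. rewrite En in Hn.
      apply HT, generated_iff in Hn as (a & m & Ha & E). eauto.
  - exists g. split; [exact Hg|]. intros x Hx. apply HgP. now exists 0.
Qed.

End Extension.

Lemma ultrahomogeneous_iff {A : Type} (f : A -> A) :
  Injective f -> ultrahomogeneous f <-> (forall y, exists x, f x = y).
Proof.
  intros Hf. split.
  - intros Huh y. apply NNPP. intros Hy.
    destruct (uh_orbit_start f [] Hf Huh y) as (n & []). eauto.
  - intros Hs. apply uh_of_starts_named; [exact Hf|].
    intros x Hx. destruct (Hs x) as (y & Hy). now apply Hx in Hy.
Qed.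

(** A named element lies on the orbit of at most one element without
    predecessor, so finitely many names leave room for finitely many of
    those. *)
Lemma starts_bounded (f : nat -> nat) (cs : list nat) :
  Injective f ->
  exists N, forall x n, (forall y, f y <> x) -> In (Nat.iter n f x) cs -> x < N.
Proof.
  intros Hf. induction cs as [|c cs (N & HN)]; [exists 0; intros x n _ []|].
  destruct (classic (exists a n, (forall y, f y <> a) /\ Nat.iter n f a = c))
    as [(a & m & Ha & Em)|Hno].
  - exists (S a + N). intros x n Hx [E|Hin]; [|specialize (HN x n Hx Hin); lia].
    enough (a = x) by lia. rewrite <- Em in E. clear Em. revert n E.
    induction m as [|m IH]; intros [|n] E; simpl in E.
    + exact E.
    + symmetry in E. now apply Ha in E.
    + now apply Hx in E.
    + exact (IH n (Hf _ _ E)).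
  - exists N. intros x n Hx [E|Hin]; [|exact (HN x n Hx Hin)].
    exfalso. apply Hno. eauto.
Qed.

Lemma weakly_ultrahomogeneous_iff (f : nat -> nat) :
  Injective f ->
  weakly_ultrahomogeneous f <->
  exists N, forall y, N <= y -> exists x, f x = y.
Proof.
  intros Hf. split.
  - intros (cs & Huh). destruct (starts_bounded f cs Hf) as (N & HN).
    exists N. intros y Hy. apply NNPP. intros Hno.
    assert (Hstart : forall x, f x <> y) by eauto.
    destruct (uh_orbit_start f cs Hf Huh y Hstart) as (n & Hn).
    specialize (HN y n Hstart Hn). lia.
  - intros (N & HN). exists (seq 0 N). apply uh_of_starts_named; [exact Hf|].
    intros x Hx. apply in_seq. destruct (le_lt_dec N x) as [L|L]; [|lia].
    destruct (HN x L) as (y & Hy). now apply Hx in Hy.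
Qed.

(** * Computable functions and decidable predicates *)

#[local] Opaque Cantor.to_nat Cantor.of_nat.

Local Notation "<< a , b >>" := (Cantor.to_nat (a, b))
  (at level 0, a at level 99, b at level 99).
Local Notation lft z := (fst (Cantor.of_nat z)).
Local Notation rgt z := (snd (Cantor.of_nat z)).

Ltac unpair := repeat (rewrite ?Cantor.cancel_of_to; cbn [fst snd]).

Lemma pair_eta z : <<lft z, rgt z>> = z.
Proof. now rewrite <- surjective_pairing, Cantor.cancel_to_of. Qed.

Lemma phi_encode c x y : phi (encode c) x y <-> eval c x y.
Proof.
  split; [|now exists c].
  intros (d & Hd & H). now rewrite <- (encode_inj _ _ Hd).
Qed.

Lemma phi_functional e x y z : phi e x y -> phi e x z -> y = z.
Proof.
  destruct (encode_surj e) as (c & <-). rewrite !phi_encode.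
  apply eval_functional.
Qed.

Lemma computable_iff f : computable f <-> exists c, forall x, eval c x (f x).
Proof.
  split.
  - intros (e & He). destruct (encode_surj e) as (c & <-).
    exists c. intros x. now apply phi_encode.
  - intros (c & Hc). exists (encode c). intros x. now apply phi_encode.
Qed.

Lemma computable_ext f g : computable f -> (forall x, f x = g x) -> computable g.
Proof.
  intros (e & He) E. exists e. intros x. rewrite <- E. apply He.
Qed.

Lemma computable_id : computable (fun x => x).
Proof.
  apply computable_iff. exists (Pair Fst Snd). intros x. simpl.
  eexists _, _. repeat split. now rewrite pair_eta.
Qed.

Fixpoint const_code (n : nat) : code :=
  match n with 0 => Zero | S m => Comp Succ (const_code m) end.

Lemma eval_const_code n x : eval (const_code n) x n.
Proof. induction n as [|n IH]; simpl; eauto. Qed.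

Lemma computable_const n : computable (fun _ => n).
Proof.
  apply computable_iff. exists (const_code n). intros x.
  apply eval_const_code.
Qed.

Lemma computable_comp g f :
  computable g -> computable f -> computable (fun x => g (f x)).
Proof.
  rewrite !computable_iff. intros (c & Hc) (d & Hd). exists (Comp c d).
  intros x. simpl. eauto.
Qed.

Lemma computable_succ f : computable f -> computable (fun x => S (f x)).
Proof.
  apply (computable_comp S). apply computable_iff. now exists Succ.
Qed.

Lemma computable_lft f : computable f -> computable (fun x => lft (f x)).
Proof.
  apply (computable_comp (fun z => lft z)). apply computable_iff. now exists Fst.
Qed.

Lemma computable_rgt f : computable f -> computable (fun x => rgt (f x)).
Proof.
  apply (computable_comp (fun z => rgt z)). apply computable_iff. now exists Snd.
Qed.

Lemma computable_pair f g :
  computable f -> computable g -> computable (fun x => <<f x, g x>>).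
Proof.
  rewrite !computable_iff. intros (c & Hc) (d & Hd). exists (Pair c d).
  intros x. simpl. eauto 6.
Qed.

Lemma computable_app2 (g : nat -> nat -> nat) a b :
  computable (fun z => g (lft z) (rgt z)) -> computable a -> computable b ->
  computable (fun x => g (a x) (b x)).
Proof.
  intros Hg Ha Hb.
  apply (computable_ext (fun x => g (lft <<a x, b x>>) (rgt <<a x, b x>>))).
  - apply (computable_comp _ _ Hg). now apply computable_pair.
  - intros x. now unpair.
Qed.

Lemma computable_rec (g : nat -> nat) (k : nat -> nat -> nat -> nat) (n : nat -> nat) :
  computable g ->
  computable (fun z => k (lft z) (lft (rgt z)) (rgt (rgt z))) ->
  computable n ->
  computable (fun x => nat_rect (fun _ => nat) (g x) (k x) (n x)).
Proof.
  intros Hg Hk Hn.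
  apply (computable_app2 (fun x m => nat_rect (fun _ => nat) (g x) (k x) m)
           (fun x => x) n); [|apply computable_id|exact Hn].
  rewrite computable_iff in *. destruct Hg as (c & Hc), Hk as (d & Hd).
  exists (Prec c d). intros z. simpl.
  generalize (lft z) (rgt z). intros x m.
  induction m as [|m IH]; simpl; [apply Hc|].
  eexists. split; [exact IH|].
  specialize (Hd <<x, <<m, nat_rect (fun _ => nat) (g x) (k x) m>>>>).
  revert Hd. now unpair.
Qed.

Lemma computable_iter (g : nat -> nat) (k : nat -> nat -> nat) (n : nat -> nat) :
  computable g -> computable (fun z => k (lft z) (rgt z)) -> computable n ->
  computable (fun x => Nat.iter (n x) (k x) (g x)).
Proof.
  intros Hg Hk Hn.
  apply (computable_rec g (fun x _ r => k x r) n); auto.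
  apply (computable_app2 k (fun z => lft z) (fun z => rgt (rgt z)));
    repeat first [exact Hk | apply computable_lft | apply computable_rgt
                 | apply computable_id].
Qed.

Definition decidable (p : nat -> bool) : Prop :=
  computable (fun x => Nat.b2n (p x)).

Lemma computable_if p f g :
  decidable p -> computable f -> computable g ->
  computable (fun x => if p x then f x else g x).
Proof.
  intros Hp Hf Hg.
  apply (computable_ext
    (fun x => nat_rect (fun _ => nat) (g x) (fun _ _ => f x) (Nat.b2n (p x)))).
  - apply (computable_rec g (fun x _ _ => f x)); auto.
    apply computable_comp; [exact Hf|]. apply computable_lft, computable_id.
  - intros x. now destruct (p x).
Qed.

Lemma decidable_negb p : decidable p -> decidable (fun x => negb (p x)).
Proof.
  intros Hp.
  apply (computable_ext (fun x => if p x then 0 else 1)).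
  - apply computable_if; auto using computable_const.
  - intros x. now destruct (p x).
Qed.

Lemma decidable_andb p q :
  decidable p -> decidable q -> decidable (fun x => p x && q x)%bool.
Proof.
  intros Hp Hq.
  apply (computable_ext (fun x => if p x then Nat.b2n (q x) else 0)).
  - apply computable_if; auto using computable_const.
  - intros x. now destruct (p x).
Qed.

Lemma decidable_orb p q :
  decidable p -> decidable q -> decidable (fun x => p x || q x)%bool.
Proof.
  intros Hp Hq.
  apply (computable_ext (fun x => if p x then 1 else Nat.b2n (q x))).
  - apply computable_if; auto using computable_const.
  - intros x. now destruct (p x).
Qed.

Lemma computable_pred f : computable f -> computable (fun x => pred (f x)).
Proof.
  intros Hf.
  apply (computable_ext
    (fun x => nat_rect (fun _ => nat) 0 (fun m _ => m) (f x))).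
  - apply (computable_rec (fun _ => 0) (fun _ m _ => m));
      auto using computable_const, computable_lft, computable_rgt, computable_id.
  - intros x. now destruct (f x).
Qed.

Lemma computable_add f g :
  computable f -> computable g -> computable (fun x => f x + g x).
Proof.
  intros Hf Hg.
  apply (computable_ext (fun x => Nat.iter (f x) S (g x))).
  - apply (computable_iter g (fun _ r => S r));
      auto using computable_succ, computable_rgt, computable_id.
  - intros x. induction (f x); simpl; auto.
Qed.

Lemma computable_sub f g :
  computable f -> computable g -> computable (fun x => f x - g x).
Proof.
  intros Hf Hg.
  apply (computable_ext (fun x => Nat.iter (g x) pred (f x))).
  - apply (computable_iter f (fun _ r => pred r));
      auto using computable_pred, computable_rgt, computable_id.
  - intros x. induction (g x) as [|m IH]; simpl; [|rewrite IH]; lia.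
Qed.

Lemma decidable_leb f g :
  computable f -> computable g -> decidable (fun x => f x <=? g x).
Proof.
  intros Hf Hg.
  apply (computable_ext (fun x => 1 - (f x - g x))).
  - auto using computable_sub, computable_const.
  - intros x. destruct (Nat.leb_spec (f x) (g x)); simpl Nat.b2n; lia.
Qed.

Lemma decidable_ltb f g :
  computable f -> computable g -> decidable (fun x => f x <? g x).
Proof.
  intros Hf Hg. apply decidable_leb; [now apply computable_succ | exact Hg].
Qed.

Lemma decidable_eqb f g :
  computable f -> computable g -> decidable (fun x => f x =? g x).
Proof.
  intros Hf Hg.
  apply (computable_ext (fun x => Nat.b2n ((f x <=? g x) && (g x <=? f x)))).
  - apply decidable_andb; now apply decidable_leb.
  - intros x. f_equal.
    destruct (Nat.leb_spec (f x) (g x)), (Nat.leb_spec (g x) (f x)),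
      (Nat.eqb_spec (f x) (g x)); simpl; lia.
Qed.

Lemma computable_div4 f : computable f -> computable (fun x => f x / 4).
Proof.
  apply (computable_comp (fun n => n / 4)).
  apply (computable_ext (fun x => nat_rect (fun _ => nat) 0
    (fun m q => if S q + (S q + (S q + S q)) <=? S m then S q else q) x)).
  - apply (computable_rec (fun _ => 0)
      (fun _ m q => if S q + (S q + (S q + S q)) <=? S m then S q else q));
      auto 12 using computable_const, computable_id, computable_if,
        decidable_leb, computable_add, computable_succ, computable_lft,
        computable_rgt.
  - intros x. symmetry. induction x as [|x IH]; [reflexivity|].
    cbn [nat_rect]. rewrite <- IH.
    pose proof (Nat.div_mod_eq x 4). pose proof (Nat.mod_upper_bound x 4).
    destruct (Nat.leb_spec (S (x / 4) + (S (x / 4) + (S (x / 4) + S (x / 4))))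
                (S x)).
    + symmetry. apply (Nat.div_unique _ _ _ 0); lia.
    + symmetry. apply (Nat.div_unique _ _ _ (S (x mod 4))); lia.
Qed.

(** Recursion on the body of a [computable] or [decidable] goal; calls of
    functions defined by recursion are left as goals. *)
Ltac comp_step :=
  match goal with
  | |- decidable (fun x => andb (@?p x) (@?q x)) => apply (decidable_andb p q)
  | |- decidable (fun x => orb (@?p x) (@?q x)) => apply (decidable_orb p q)
  | |- decidable (fun x => negb (@?p x)) => apply (decidable_negb p)
  | |- decidable (fun x => Nat.eqb (@?p x) (@?q x)) => apply (decidable_eqb p q)
  | |- decidable (fun x => Nat.ltb (@?p x) (@?q x)) => apply (decidable_ltb p q)
  | |- decidable (fun x => Nat.leb (@?p x) (@?q x)) => apply (decidable_leb p q)
  | |- computable (fun x => ?n) => apply (computable_const n)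
  | |- computable (fun x => x) => apply computable_id
  | |- computable (fun x => S (@?f x)) => apply (computable_succ f)
  | |- computable (fun x => pred (@?f x)) => apply (computable_pred f)
  | |- computable (fun x => lft (@?f x)) => apply (computable_lft f)
  | |- computable (fun x => rgt (@?f x)) => apply (computable_rgt f)
  | |- computable (fun x => <<@?f x, @?g x>>) => apply (computable_pair f g)
  | |- computable (fun x => @?f x + @?g x) => apply (computable_add f g)
  | |- computable (fun x => @?f x - @?g x) => apply (computable_sub f g)
  | |- computable (fun x => @?f x / 4) => apply (computable_div4 f)
  | |- computable (fun x => if @?p x then @?f x else @?g x) =>
      apply (computable_if p f g)
  | |- _ => assumption
  end.
Ltac comp := repeat (cbv beta; comp_step).

(** * A universal machine *)

(** The continuations of a computation in progress: what remains to be done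
    once the pending subcomputation has returned a value.  In [prec_frame] the
    value awaited is that of the recursion at [m], on its way to [n]; in
    [mu_frame] it is that of [c] at the candidate [z]. *)
Definition pair_snd_frame d x := <<0, <<d, x>>>>.
Definition pair_done_frame u := <<1, u>>.
Definition comp_frame c := <<2, c>>.
Definition prec_frame d a m n := <<3, <<d, <<a, <<m, n>>>>>>>>.
Definition mu_frame c x z := <<4, <<c, <<x, z>>>>>>.

Definition push fr K := S <<fr, K>>.

(** A state either returns [v] to the stack [K] or starts the program with
    number [e] on input [v]; the empty stack is [0]. *)
Definition ret v K := <<0, <<v, K>>>>.
Definition start e v K := <<S e, <<v, K>>>>.

Definition step_ret (z v K : nat) : nat :=
  if K =? 0 then z else
  let fr := lft (pred K) in
  let K := rgt (pred K) in
  let args := rgt fr in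
  if lft fr =? 0 then start (lft args) (rgt args) (push (pair_done_frame v) K)
  else if lft fr =? 1 then ret <<args, v>> K
  else if lft fr =? 2 then start args v K
  else if lft fr =? 3 then
    let d := lft args in
    let a := lft (rgt args) in
    let m := lft (rgt (rgt args)) in
    let n := rgt (rgt (rgt args)) in
    if m =? n then ret v K
    else start d <<a, <<m, v>>>> (push (prec_frame d a (S m) n) K)
  else
    let c := lft args in
    let x := lft (rgt args) in
    let z := rgt (rgt args) in
    if v =? 0 then ret z K
    else start c <<x, S z>> (push (mu_frame c x (S z)) K).

Definition step_start (e v K : nat) : nat :=
  if e =? 0 then ret 0 K
  else if e =? 1 then ret (S v) K
  else if e =? 2 then ret (lft v) K
  else if e =? 3 then ret (rgt v) K
  else
    let q := (e - 4) / 4 in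
    let r := (e - 4) - (q + (q + (q + q))) in
    if r =? 0 then start (lft q) v (push (pair_snd_frame (rgt q) v) K)
    else if r =? 1 then start (rgt q) v (push (comp_frame (lft q)) K)
    else if r =? 2 then
      start (lft q) (lft v) (push (prec_frame (rgt q) (lft v) 0 (rgt v)) K)
    else start q <<v, 0>> (push (mu_frame q v 0) K).

Definition step (z : nat) : nat :=
  if lft z =? 0 then step_ret z (lft (rgt z)) (rgt (rgt z))
  else step_start (pred (lft z)) (lft (rgt z)) (rgt (rgt z)).

Lemma computable_step : computable step.
Proof.
  unfold step, step_ret, step_start, ret, start, push, pair_snd_frame,
    pair_done_frame, comp_frame, prec_frame, mu_frame.
  cbv zeta. comp.
Qed.

Lemma step_ret_empty v : step (ret v 0) = ret v 0.
Proof. unfold step, ret. now unpair. Qed.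

Ltac run_ret := unfold step, ret; unpair; simpl Nat.eqb; cbv iota;
  unfold step_ret, push; simpl Nat.eqb; cbv iota; simpl pred;
  unfold pair_snd_frame, pair_done_frame, comp_frame, prec_frame, mu_frame;
  cbv zeta; unpair; simpl Nat.eqb; cbv iota.

Lemma step_pair_snd u d x K :
  step (ret u (push (pair_snd_frame d x) K)) =
  start d x (push (pair_done_frame u) K).
Proof. now run_ret. Qed.

Lemma step_pair_done u v K :
  step (ret v (push (pair_done_frame u) K)) = ret <<u, v>> K.
Proof. now run_ret. Qed.

Lemma step_comp u c K : step (ret u (push (comp_frame c) K)) = start c u K.
Proof. now run_ret. Qed.

Lemma step_prec u d a m n K :
  step (ret u (push (prec_frame d a m n) K)) =
  if m =? n then ret u K
  else start d <<a, <<m, u>>>> (push (prec_frame d a (S m) n) K).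
Proof. now run_ret. Qed.

Lemma step_mu v c x z K :
  step (ret v (push (mu_frame c x z) K)) =
  if v =? 0 then ret z K
  else start c <<x, S z>> (push (mu_frame c x (S z)) K).
Proof. now run_ret. Qed.

Lemma step_start_code c x K :
  step (start (encode c) x K) =
  match c with
  | Zero => ret 0 K
  | Succ => ret (S x) K
  | Fst => ret (lft x) K
  | Snd => ret (rgt x) K
  | Pair c d =>
      start (encode c) x (push (pair_snd_frame (encode d) x) K)
  | Comp c d => start (encode d) x (push (comp_frame (encode c)) K)
  | Prec c d =>
      start (encode c) (lft x)
        (push (prec_frame (encode d) (lft x) 0 (rgt x)) K)
  | Mu c => start (encode c) <<x, 0>> (push (mu_frame (encode c) x 0) K)
  end.
Proof.
  replace (step (start (encode c) x K)) with (step_start (encode c) x K)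
    by (unfold step, start; now unpair).
  assert (Hq : forall q r, r < 4 -> (4 + r + 4 * q - 4) / 4 = q).
  { intros q r Hr. symmetry. apply (Nat.div_unique _ 4 _ r); lia. }
  assert (Hr : forall q r, 4 + r + 4 * q - 4 - (q + (q + (q + q))) = r) by lia.
  assert (Hcode : forall q r, r < 4 -> step_start (4 + r + 4 * q) x K =
    if r =? 0 then start (lft q) x (push (pair_snd_frame (rgt q) x) K)
    else if r =? 1 then start (rgt q) x (push (comp_frame (lft q)) K)
    else if r =? 2 then
      start (lft q) (lft x) (push (prec_frame (rgt q) (lft x) 0 (rgt x)) K)
    else start q <<x, 0>> (push (mu_frame q x 0) K)).
  { intros q r H. unfold step_start.
    replace (4 + r + 4 * q =? 0) with false by reflexivity.
    replace (4 + r + 4 * q =? 1) with false by reflexivity.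
    replace (4 + r + 4 * q =? 2) with false by reflexivity.
    replace (4 + r + 4 * q =? 3) with false by reflexivity.
    cbv iota zeta. rewrite (Hq q r H). now rewrite (Hr q r). }
  destruct c as [ | | | |c d|c d|c d|c]; try reflexivity; cbn [encode].
  - etransitivity; [apply (Hcode _ 0); lia|]. simpl Nat.eqb. now unpair.
  - etransitivity; [apply (Hcode _ 1); lia|]. simpl Nat.eqb. now unpair.
  - etransitivity; [apply (Hcode _ 2); lia|]. simpl Nat.eqb. now unpair.
  - etransitivity; [apply (Hcode _ 3); lia|]. reflexivity.
Qed.

Definition reaches (s t : nat) : Prop := exists n, Nat.iter n step s = t.

Lemma reaches_refl s : reaches s s.
Proof. now exists 0. Qed.

Lemma reaches_step s t : reaches (step s) t -> reaches s t.
Proof. intros (n & Hn). exists (S n). now rewrite Nat.iter_succ_r. Qed.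

Lemma reaches_trans s t u : reaches s t -> reaches t u -> reaches s u.
Proof.
  intros (n & Hn) (m & Hm). exists (m + n). now rewrite Nat.iter_add, Hn.
Qed.

Lemma machine_complete c :
  forall x y K, eval c x y -> reaches (start (encode c) x K) (ret y K).
Proof.
  induction c as [ | | | |c IHc d IHd|c IHc d IHd|c IHc d IHd|c IHc];
    intros x y K H; simpl in H; apply reaches_step; rewrite step_start_code.
  1-4: subst y; apply reaches_refl.
  - destruct H as (u & v & Hu & Hv & ->).
    eapply reaches_trans; [exact (IHc _ _ _ Hu)|].
    apply reaches_step. rewrite step_pair_snd.
    eapply reaches_trans; [exact (IHd _ _ _ Hv)|].
    apply reaches_step. rewrite step_pair_done. apply reaches_refl.
  - destruct H as (u & Hu & Hy).
    eapply reaches_trans; [exact (IHd _ _ _ Hu)|].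
    apply reaches_step. rewrite step_comp. exact (IHc _ _ _ Hy).
  - revert H. generalize (lft x) (rgt x). intros a n H.
    (* The loop is followed up to an arbitrary iteration [m]. *)
    assert (Hloop : forall m u, m <= n -> primrec (eval c) (eval d) a m u ->
      reaches (start (encode c) a (push (prec_frame (encode d) a 0 n) K))
              (ret u (push (prec_frame (encode d) a m n) K))).
    { induction m as [|m IH]; simpl; intros u Hm Hu; [exact (IHc _ _ _ Hu)|].
      destruct Hu as (v & Hv & Hu).
      eapply reaches_trans; [apply (IH v); [lia | exact Hv]|].
      apply reaches_step. rewrite step_prec.
      destruct (Nat.eqb_spec m n); [lia|]. exact (IHd _ _ _ Hu). }
    eapply reaches_trans; [apply (Hloop n y); [lia | exact H]|].
    apply reaches_step. rewrite step_prec, Nat.eqb_refl. apply reaches_refl.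
  - destruct H as (Hy & Hlt).
    assert (Hloop : forall z, z <= y ->
      reaches (start (encode c) <<x, 0>> (push (mu_frame (encode c) x 0) K))
              (start (encode c) <<x, z>> (push (mu_frame (encode c) x z) K))).
    { induction z as [|z IH]; intros Hz; [apply reaches_refl|].
      eapply reaches_trans; [apply IH; lia|].
      destruct (Hlt z) as (v & Hv); [lia|].
      eapply reaches_trans; [exact (IHc _ _ _ Hv)|].
      apply reaches_step. rewrite step_mu. apply reaches_refl. }
    eapply reaches_trans; [apply (Hloop y); lia|].
    eapply reaches_trans; [exact (IHc _ _ _ Hy)|].
    apply reaches_step. rewrite step_mu. apply reaches_refl.
Qed.

Lemma halting_step n s y :
  (forall v, s <> ret v 0) -> Nat.iter n step s = ret y 0 ->
  exists m, n = S m /\ Nat.iter m step (step s) = ret y 0.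
Proof.
  intros Hs H. destruct n as [|m]; [now apply Hs in H|].
  exists m. now rewrite <- Nat.iter_succ_r.
Qed.

Lemma start_not_final e v K w : start e v K <> ret w 0.
Proof.
  intros E. apply Cantor.to_nat_inj in E. discriminate.
Qed.

Lemma ret_not_final v fr K w : ret v (push fr K) <> ret w 0.
Proof.
  intros E. apply Cantor.to_nat_inj in E. injection E as E.
  apply Cantor.to_nat_inj in E. discriminate.
Qed.

(** A halting run must pop every frame, so each subcomputation returns, and
    in fewer steps than the whole run takes; the latter bound is what makes
    the induction for the search loop go through. *)
Lemma machine_sound c :
  forall n x K y, Nat.iter n step (start (encode c) x K) = ret y 0 ->
  exists v m, m < n /\ eval c x v /\ Nat.iter m step (ret v K) = ret y 0.
Proof.
  induction c as [ | | | |c IHc d IHd|c IHc d IHd|c IHc d IHd|c IHc];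
    intros n x K y H;
    apply halting_step in H as (m & -> & H); try apply start_not_final;
    rewrite step_start_code in H.
  1-4: eexists _, m; split; [lia|]; split; [reflexivity | exact H].
  - apply IHc in H as (u & m1 & L1 & Hu & H).
    apply halting_step in H as (m2 & -> & H); [|intros; apply ret_not_final].
    rewrite step_pair_snd in H.
    apply IHd in H as (v & m3 & L3 & Hv & H).
    apply halting_step in H as (m4 & -> & H); [|intros; apply ret_not_final].
    rewrite step_pair_done in H.
    exists <<u, v>>, m4. simpl. split; [lia|]. eauto 7.
  - apply IHd in H as (u & m1 & L1 & Hu & H).
    apply halting_step in H as (m2 & -> & H); [|intros; apply ret_not_final].
    rewrite step_comp in H.
    apply IHc in H as (v & m3 & L3 & Hv & H).
    exists v, m3. simpl. split; [lia|]. eauto.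
  - simpl. revert H. generalize (lft x) (rgt x). intros a k H.
    apply IHc in H as (u & m1 & L1 & Hu & H).
    assert (Hloop : forall i j m1 u, i + j = k ->
      primrec (eval c) (eval d) a i u ->
      Nat.iter m1 step (ret u (push (prec_frame (encode d) a i k) K)) = ret y 0 ->
      exists v m2, m2 < m1 /\ primrec (eval c) (eval d) a k v /\
        Nat.iter m2 step (ret v K) = ret y 0).
    { clear m1 u L1 Hu H. intros i j; revert i.
      induction j as [|j IHj]; intros i m1 u Hij Hu H;
        apply halting_step in H as (m2 & -> & H); try apply ret_not_final;
        rewrite step_prec in H.
      - replace i with k in * by lia. rewrite Nat.eqb_refl in H.
        exists u, m2. split; [lia|]. auto.
      - destruct (Nat.eqb_spec i k); [lia|].
        apply IHd in H as (v & m3 & L3 & Hv & H).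
        destruct (IHj (S i) m3 v) as (w & m4 & L4 & Hw & H'); simpl; eauto;
          [lia|].
        exists w, m4. split; [lia|]. auto. }
    destruct (Hloop 0 k m1 u) as (v & m2 & L2 & Hv & H'); auto.
    exists v, m2. split; [lia|]. auto.
  - assert (Hloop : forall m z,
      (forall z', z' < z -> exists v, eval c <<x, z'>> (S v)) ->
      Nat.iter m step (start (encode c) <<x, z>>
                         (push (mu_frame (encode c) x z) K)) = ret y 0 ->
      exists w m', m' < m /\ eval (Mu c) x w /\
        Nat.iter m' step (ret w K) = ret y 0).
    { clear m H. induction m as [m IHm] using lt_wf_ind. intros z Hz H.
      apply IHc in H as (v & m1 & L1 & Hv & H).
      apply halting_step in H as (m2 & -> & H); [|intros; apply ret_not_final].
      rewrite step_mu in H. destruct v as [|v]; simpl in H.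
      - exists z, m2. simpl. split; [lia|]. auto.
      - destruct (IHm m2) with (z := S z) as (w & m' & L' & Hw & H'); auto; [lia| |].
        + intros z' Hz'. destruct (Nat.eq_dec z' z) as [->|]; [eauto|].
          apply Hz. lia.
        + exists w, m'. split; [lia|]. auto. }
    destruct (Hloop m 0) as (w & m' & L & Hw & H'); auto; [intros; lia|].
    exists w, m'. split; [lia|]. auto.
Qed.

(** Kleene's T predicate: [w] bounds the running time. *)
Definition halts_with (e x y w : nat) : bool :=
  Nat.iter w step (start e x 0) =? ret y 0.

Lemma phi_iff e x y : phi e x y <-> exists w, halts_with e x y w = true.
Proof.
  destruct (encode_surj e) as (c & <-). rewrite phi_encode. split.
  - intros H. destruct (machine_complete c x y 0 H) as (w & Hw).
    exists w. now apply Nat.eqb_eq.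
  - intros (w & Hw). apply Nat.eqb_eq in Hw.
    apply machine_sound in Hw as (v & m & _ & Hv & H).
    assert (E : ret v 0 = ret y 0).
    { rewrite <- H. clear H. induction m as [|m IH]; [reflexivity|].
      simpl. now rewrite <- IH, step_ret_empty. }
    apply Cantor.to_nat_inj in E. injection E as E.
    apply Cantor.to_nat_inj in E. injection E as ->. exact Hv.
Qed.

Lemma decidable_halts_with e x y w :
  computable e -> computable x -> computable y -> computable w ->
  decidable (fun n => halts_with (e n) (x n) (y n) (w n)).
Proof.
  intros He Hx Hy Hw. unfold halts_with, start, ret. apply decidable_eqb; comp.
  apply (computable_iter _ (fun _ => step)); comp.
  apply computable_comp; [apply computable_step | comp].
Qed.

(** * The index sets are in their classes *)

Lemma decidable_set p : decidable p -> computable_set (fun n => p n = true).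
Proof.
  intros Hp. exists (fun n => Nat.b2n (p n)). split; [exact Hp|].
  intros n. destruct (p n); [now left | now right].
Qed.

Lemma computable_set_iff D :
  computable_set D -> exists p, decidable p /\ forall n, D n <-> p n = true.
Proof.
  intros (chi & Hchi & H). exists (fun n => chi n =? 1). split.
  - apply decidable_eqb; [exact Hchi | apply computable_const].
  - intros n. rewrite Nat.eqb_eq. destruct (H n) as [(Hn & ->)|(Hn & ->)];
      split; easy.
Qed.

Lemma Pi02_intro (A : nat -> Prop) (p : nat -> nat -> nat -> bool) :
  decidable (fun z => p (lft (lft z)) (rgt (lft z)) (rgt z)) ->
  (forall n, A n <-> forall a, exists b, p n a b = true) -> Pi0 2 A.
Proof.
  intros Hp HA.
  exists (fun m => exists b, p (lft m) (rgt m) b = true). split.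
  - exists (fun z => p (lft (lft z)) (rgt (lft z)) (rgt z) = true). split.
    + now apply decidable_set.
    + intros m. split; intros (b & Hb); exists b; revert Hb; now unpair.
  - intros n. rewrite HA. split; intros H a; destruct (H a) as (b & Hb);
      exists b; revert Hb; now unpair.
Qed.

(** The bound [N] allows one analysis for both index sets: it is [0] for
    ultrahomogeneity and existentially quantified for the weak form. *)
Definition INJ_onto_from (e N : nat) : Prop :=
  exists f, injection_structure e f /\ forall y, N <= y -> exists x, f x = y.

Lemma UHI_iff e : UHI e <-> INJ_onto_from e 0.
Proof.
  split; intros (f & Hf & H); exists f; (split; [exact Hf|]);
    pose proof (proj2 Hf) as Hinj.
  - intros y _. now apply ultrahomogeneous_iff.
  - apply ultrahomogeneous_iff; [exact Hinj|]. intros y. apply H. lia.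
Qed.

Lemma WUI_iff e : WUI e <-> exists N, INJ_onto_from e N.
Proof.
  split.
  - intros (f & Hf & H). apply weakly_ultrahomogeneous_iff in H as (N & HN);
      [|apply Hf]. now exists N, f.
  - intros (N & f & Hf & HN). exists f. split; [exact Hf|].
    apply weakly_ultrahomogeneous_iff; [apply Hf | eauto].
Qed.

(** Totality, injectivity and surjectivity in one decidable matrix under
    the quantifiers [forall a, exists b]: [a] supplies [x] and a candidate
    collision [x], [x'], [y] with the two running times; [b] supplies the
    value at [x] and a preimage of [x], again with running times. *)
Definition onto_matrix (e N a b : nat) : bool :=
  let x := lft a in
  let x' := lft (rgt a) in
  let y := lft (rgt (rgt a)) in
  let w := lft (rgt (rgt (rgt a))) in
  let w' := rgt (rgt (rgt (rgt a))) in
  halts_with e x (lft (lft b)) (rgt (lft b)) &&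
  ((x <? N) || halts_with e (lft (rgt b)) x (rgt (rgt b))) &&
  negb (halts_with e x y w && halts_with e x' y w' && negb (x =? x')).

Lemma decidable_onto_matrix e N a b :
  computable e -> computable N -> computable a -> computable b ->
  decidable (fun z => onto_matrix (e z) (N z) (a z) (b z)).
Proof.
  intros He HN Ha Hb. unfold onto_matrix. cbv zeta.
  comp; apply decidable_halts_with; comp.
Qed.

Lemma INJ_onto_from_iff e N :
  INJ_onto_from e N <-> forall a, exists b, onto_matrix e N a b = true.
Proof.
  split.
  - intros (f & (Hf & Hinj) & Hon) a.
    assert (Hf' : forall x, exists w, halts_with e x (f x) w = true)
      by (intros; now apply phi_iff).
    destruct (Hf' (lft a)) as (u & Hu).
    assert (exists x0 w, (lft a <? N) || halts_with e x0 (lft a) w = true)%bool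
      as (x0 & w0 & H0).
    { destruct (Nat.ltb_spec (lft a) N) as [L|L]; [now exists 0, 0|].
      destruct (Hon _ L) as (x0 & <-). destruct (Hf' x0) as (w & Hw).
      now exists x0, w. }
    exists <<<<f (lft a), u>>, <<x0, w0>>>>. unfold onto_matrix. cbv zeta.
    unpair. rewrite Hu, H0. simpl.
    set (x := lft a). set (x' := lft (rgt a)).
    destruct (halts_with e x _ _) eqn:E1; [|reflexivity].
    destruct (halts_with e x' _ _) eqn:E2; [|reflexivity].
    simpl. rewrite Bool.negb_involutive. apply Nat.eqb_eq, Hinj.
    assert (H : forall z y w, halts_with e z y w = true -> f z = y).
    { intros z y w H. apply (phi_functional e z); [apply Hf|].
      apply phi_iff. eauto. }
    rewrite (H _ _ _ E1). symmetry. exact (H _ _ _ E2).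
  - intros H.
    assert (Htot : forall x, exists y, phi e x y).
    { intros x. destruct (H <<x, 0>>) as (b & Hb).
      unfold onto_matrix in Hb. cbv zeta in Hb.
      apply andb_prop in Hb as (Hb & _). apply andb_prop in Hb as (Hb & _).
      revert Hb. unpair. intros Hb. exists (lft (lft b)). apply phi_iff. eauto. }
    set (f := fun x => proj1_sig (constructive_indefinite_description _ (Htot x))).
    assert (Hf : forall x, phi e x (f x)).
    { intros x. unfold f. apply proj2_sig. }
    exists f. split; [split; [exact Hf|]|].
    + intros x x' E. pose proof (Hf x) as Hx. pose proof (Hf x') as Hx'.
      rewrite <- E in Hx'. apply phi_iff in Hx as (w & Hw), Hx' as (w' & Hw').
      destruct (H <<x, <<x', <<f x, <<w, w'>>>>>>>>) as (b & Hb).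
      unfold onto_matrix in Hb. cbv zeta in Hb.
      apply andb_prop in Hb as (_ & Hb). revert Hb. unpair.
      rewrite Hw, Hw'. simpl. rewrite Bool.negb_involutive.
      apply Nat.eqb_eq.
    + intros y Hy. destruct (H <<y, 0>>) as (b & Hb).
      unfold onto_matrix in Hb. cbv zeta in Hb.
      apply andb_prop in Hb as (Hb & _). apply andb_prop in Hb as (_ & Hb).
      revert Hb. unpair. destruct (Nat.ltb_spec y N); [lia|]. simpl. intros Hb.
      exists (lft (rgt b)).
      apply (phi_functional e (lft (rgt b))); [apply Hf|].
      apply phi_iff. eauto.
Qed.

Lemma UHI_Pi02 : Pi0 2 UHI.
Proof.
  apply (Pi02_intro _ (fun e a b => onto_matrix e 0 a b)).
  - apply decidable_onto_matrix; comp.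
  - intros e. now rewrite UHI_iff, INJ_onto_from_iff.
Qed.

Lemma WUI_Sigma03 : Sigma0 3 WUI.
Proof.
  exists (fun m => INJ_onto_from (lft m) (rgt m)). split.
  - apply (Pi02_intro _ (fun m a b => onto_matrix (lft m) (rgt m) a b)).
    + apply decidable_onto_matrix; comp.
    + intros m. apply INJ_onto_from_iff.
  - intros e. rewrite WUI_iff.
    split; intros (N & HN); exists N; revert HN; now unpair.
Qed.

(** * Pi^0_2 statements as recurring events *)

Section Search.
Context (d : nat -> nat -> bool).

(** A search for witnesses of [forall y, exists z, d y z]: the state is the
    current [y] and the candidate [z], and every success moves on to the next
    [y]. *)
Definition search (t : nat) : nat :=
  nat_rect (fun _ => nat) <<0, 0>>
    (fun _ r => if d (lft r) (rgt r) then <<S (lft r), 0>>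
                else <<lft r, S (rgt r)>>) t.

Definition success (t : nat) : bool := d (lft (search t)) (rgt (search t)).

Lemma search_succ t :
  search (S t) = if success t then <<S (lft (search t)), 0>>
                 else <<lft (search t), S (rgt (search t))>>.
Proof. reflexivity. Qed.

Lemma search_invariant t :
  (forall y, y < lft (search t) -> exists z, d y z = true) /\
  (forall z, z < rgt (search t) -> d (lft (search t)) z = false).
Proof.
  induction t as [|t (IH1 & IH2)].
  - unfold search. simpl. unpair. split; intros; lia.
  - rewrite search_succ. destruct (success t) eqn:E; unpair.
    + split; [|intros; lia]. intros y Hy.
      destruct (Nat.eq_dec y (lft (search t))) as [->|]; [eauto|].
      apply IH1. lia.
    + split; [exact IH1|]. intros z Hz.
      destruct (Nat.eq_dec z (rgt (search t))) as [->|]; [exact E|].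
      apply IH2. lia.
Qed.

Lemma success_recurrent :
  (forall y, exists z, d y z = true) <->
  (forall t0, exists t, t0 <= t /\ success t = true).
Proof.
  split.
  - intros H t0. destruct (H (lft (search t0))) as (z & Hz).
    assert (Hle : rgt (search t0) <= z).
    { destruct (le_lt_dec (rgt (search t0)) z) as [L|L]; [exact L|].
      rewrite (proj2 (search_invariant t0) _ L) in Hz. discriminate. }
    remember (z - rgt (search t0)) as k eqn:Ek. revert t0 Hz Hle Ek.
    induction k as [|k IH]; intros t0 Hz Hle Ek;
      destruct (success t0) eqn:E; [eauto| |eauto|].
    + unfold success in E. replace (rgt (search t0)) with z in E by lia.
      congruence.
    + destruct (IH (S t0)) as (t & Ht & Hs);
        [rewrite search_succ, E; unpair; auto with arith; lia ..|].
      exists t. split; [lia | exact Hs].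
  - intros H y.
    assert (Hy : exists t, y < lft (search t)).
    { clear -H. induction y as [|y (t0 & IH)].
      - destruct (H 0) as (t & _ & Ht). exists (S t).
        rewrite search_succ, Ht. unpair. lia.
      - destruct (H t0) as (t & Hle & Ht). exists (S t).
        assert (Hmono : forall k, lft (search t0) <= lft (search (k + t0))).
        { induction k as [|k IHk]; [reflexivity|].
          change (S k + t0) with (S (k + t0)). rewrite search_succ.
          destruct (success (k + t0)); unpair; lia. }
        specialize (Hmono (t - t0)).
        replace (t - t0 + t0) with t in Hmono by lia.
        rewrite search_succ, Ht. unpair. lia. }
    destruct Hy as (t & Ht). exact (proj1 (search_invariant t) y Ht).
Qed.
End Search.

Lemma Pi02_recurrent (A : nat -> Prop) :
  Pi0 2 A ->
  exists ev : nat -> nat -> bool,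
    decidable (fun z => ev (lft z) (rgt z)) /\
    forall n, A n <-> forall t0, exists t, t0 <= t /\ ev n t = true.
Proof.
  intros (B & (D & HD & HB) & HA).
  apply computable_set_iff in HD as (p & Hp & HD).
  exists (fun n => success (fun y z => p <<<<n, y>>, z>>)). split.
  - assert (Hs : computable (fun x =>
      search (fun y z => p <<<<lft x, y>>, z>>) (rgt x))).
    { unfold search.
      apply (computable_rec _ (fun x _ r =>
        if p <<<<lft x, lft r>>, rgt r>> then <<S (lft r), 0>>
        else <<lft r, S (rgt r)>>)); comp.
      apply (computable_comp (fun z => Nat.b2n (p z))); [exact Hp | comp]. }
    apply (computable_comp (fun z => Nat.b2n (p z))); [exact Hp | comp].
  - intros n. rewrite <- success_recurrent, HA.
    split; intros H y; specialize (H y); apply HB in H || apply HB;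
      destruct H as (z & Hz); exists z; now apply HD.
Qed.

(** * An injection missing as many elements as prescribed *)

Section Survivors.
Context (e : nat -> nat).

(** Throw away, at stage [s], the element of rank [e s] among those that
    are left.  [survivor s p] is the element of rank [p] left before stage
    [s], and [discard] enumerates without repetition what is thrown away. *)
Fixpoint survivor (s p : nat) : nat :=
  match s with
  | 0 => p
  | S t => survivor t (if p <? e t then p else S p)
  end.

Definition discard (s : nat) : nat := survivor s (e s).

Lemma survivor_inj s : Injective (survivor s).
Proof.
  induction s as [|s IH]; simpl; intros p q E; [exact E|].
  apply IH in E.
  destruct (Nat.ltb_spec p (e s)), (Nat.ltb_spec q (e s)); lia.
Qed.

Lemma survivor_succ_neq s p : survivor (S s) p <> discard s.
Proof.
  simpl. intros E. apply survivor_inj in E.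
  destruct (Nat.ltb_spec p (e s)); lia.
Qed.

Lemma survivor_earlier s k p : exists q, survivor (k + s) p = survivor s q.
Proof.
  revert p; induction k as [|k IH]; intros p; [now exists p|]. apply IH.
Qed.

Lemma discard_inj : Injective discard.
Proof.
  assert (H : forall s t, s < t -> discard s <> discard t).
  { intros s t Hst E. unfold discard at 2 in E.
    replace t with (t - S s + S s) in E by lia.
    destruct (survivor_earlier (S s) (t - S s) (e (t - S s + S s))) as (q & Hq).
    rewrite Hq in E. symmetry in E. exact (survivor_succ_neq _ _ E). }
  intros s t E. destruct (Nat.lt_trichotomy s t) as [L|[L|L]]; auto.
  - now apply H in E.
  - symmetry in E. now apply H in E.
Qed.

Lemma kept_survives y s :
  (forall t, discard t <> y) -> exists p, y = survivor s p.
Proof.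
  intros Hy. induction s as [|s (p & ->)]; [now exists y|].
  destruct (Nat.lt_trichotomy p (e s)) as [L|[L|L]].
  - exists p. simpl. destruct (Nat.ltb_spec p (e s)); [reflexivity | lia].
  - subst p. now elim (Hy s).
  - exists (pred p). simpl.
    destruct (Nat.ltb_spec (pred p) (e s)); [lia | f_equal; lia].
Qed.

(** The rank of an element that is never thrown away decreases whenever
    something below it is, and so is eventually less than all [e s]. *)
Lemma kept_rank_stabilises y s :
  (forall t, discard t <> y) ->
  exists s' p, s <= s' /\ y = survivor s' p /\ forall t, s' <= t -> p < e t.
Proof.
  intros Hy. destruct (kept_survives y s Hy) as (p & Hp).
  revert s Hp. induction p as [p IH] using lt_wf_ind. intros s Hp.
  destruct (classic (forall t, s <= t -> p < e t)) as [H|H].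
  { exists s, p. auto. }
  assert (Ht : exists t, s <= t /\ e t <= p).
  { apply NNPP. intros Hno. apply H. intros t Ht.
    destruct (le_lt_dec (e t) p); [|assumption]. elim Hno. eauto. }
  destruct Ht as (t & Ht & Hle).
  remember (t - s) as k eqn:Ek. revert s Hp Ht H Ek.
  induction k as [|k IHk]; intros s Hp Ht H Ek.
  - replace t with s in * by lia.
    destruct (Nat.eq_dec (e s) p) as [E|E].
    + subst p. now elim (Hy s).
    + destruct (IH (pred p)) with (s := S s) as (s' & q & L & Hq); [lia| |].
      * simpl. destruct (Nat.ltb_spec (pred p) (e s)); [lia|].
        rewrite Hp. f_equal. lia.
      * exists s', q. split; [lia | exact Hq].
  - destruct (Nat.lt_trichotomy p (e s)) as [L|[L|L]].
    + destruct (IHk (S s)) as (s' & q & L' & Hq); [| lia | | lia |].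
      * simpl. destruct (Nat.ltb_spec p (e s)); [exact Hp | lia].
      * intros H'. apply H. intros u Hu.
        destruct (Nat.eq_dec u s) as [->|]; [exact L|]. apply H'. lia.
      * exists s', q. split; [lia | exact Hq].
    + subst p. now elim (Hy s).
    + destruct (IH (pred p)) with (s := S s) as (s' & q & L' & Hq); [lia| |].
      * simpl. destruct (Nat.ltb_spec (pred p) (e s)); [lia|].
        rewrite Hp. f_equal. lia.
      * exists s', q. split; [lia | exact Hq].
Qed.

Definition recurrent (k : nat) : Prop := forall s, exists t, s <= t /\ e t = k.

Lemma survivor_fixed s k p :
  (forall t, s <= t -> p < e t) -> survivor (k + s) p = survivor s p.
Proof.
  intros H. induction k as [|k IH]; [reflexivity|]. simpl.
  specialize (H (k + s)). destruct (Nat.ltb_spec p (e (k + s))); [exact IH|lia].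
Qed.

Lemma discard_onto : recurrent 0 -> forall y, exists s, discard s = y.
Proof.
  intros H y. apply NNPP. intros Hno.
  destruct (kept_rank_stabilises y 0) as (s & p & _ & _ & Hp); [eauto|].
  destruct (H s) as (t & Ht & E). specialize (Hp t Ht). lia.
Qed.

Lemma discard_onto_from k :
  recurrent k -> exists N, forall y, N <= y -> exists s, discard s = y.
Proof.
  (* By pigeonhole: [k + 1] kept elements would have distinct final ranks
     below [k]. *)
  intros Hk. apply NNPP. intros Hno.
  assert (Hkept : forall m, exists l s, length l = m /\ NoDup l /\
            (forall p, In p l -> (forall t, discard t <> survivor s p) /\
                         forall t, s <= t -> p < e t)).
  { induction m as [|m (l & s & Hlen & Hnd & Hl)].
    { exists [], 0. repeat split; [constructor | easy..]. }
    set (N := S (list_max (map (survivor s) l))).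
    assert (Hy : exists y, N <= y /\ forall t, discard t <> y).
    { apply NNPP. intros Hy. apply Hno. exists N. intros y HyN.
      apply NNPP. intros Hns. apply Hy. exists y. split; eauto. }
    destruct Hy as (y & HyN & Hy).
    destruct (kept_rank_stabilises y s Hy) as (s' & p & Hs & Ey & Hp).
    assert (Hfix : forall q, In q l -> survivor s' q = survivor s q).
    { intros q Hq. replace s' with (s' - s + s) by lia.
      apply survivor_fixed, Hl, Hq. }
    exists (p :: l), s'. repeat split.
    - simpl. now f_equal.
    - constructor; [|exact Hnd]. intros Hin.
      assert (Hmax : survivor s p <= list_max (map (survivor s) l)).
      { pose proof (proj1 (list_max_le (map (survivor s) l) _) (le_n _)) as Hall.
        rewrite Forall_forall in Hall. apply Hall, in_map, Hin. }
      rewrite (Hfix p Hin) in Ey. lia.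
    - destruct H as [<-|Hq]; [now rewrite <- Ey|].
      rewrite (Hfix _ Hq). now apply Hl.
    - destruct H as [<-|Hq]; [exact Hp|].
      intros t Ht. apply (Hl _ Hq). lia. }
  destruct (Hkept (S k)) as (l & s & Hlen & Hnd & Hl).
  assert (length l <= length (seq 0 k)).
  { apply NoDup_incl_length; [exact Hnd|]. intros p Hp. apply in_seq.
    destruct (Hk s) as (t & Ht & E). pose proof (proj2 (Hl p Hp) t Ht). lia. }
  rewrite length_seq in *. lia.
Qed.

Lemma not_recurrent_below p :
  (forall k, k <= p -> ~ recurrent k) ->
  exists s, forall t, s <= t -> p < e t.
Proof.
  intros H.
  assert (Hk : forall k, k <= p -> exists s, forall t, s <= t -> e t <> k).
  { intros k Hk. apply NNPP. intros Hno. apply (H k Hk). intros s.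
    apply NNPP. intros Hs. apply Hno. exists s. intros t Ht E. eauto. }
  clear H. induction p as [|p IH].
  - destruct (Hk 0 (le_n _)) as (s & Hs). exists s. intros t Ht.
    specialize (Hs t Ht). lia.
  - destruct IH as (s2 & H2); [intros k Hle; apply Hk; lia|].
    destruct (Hk (S p) (le_n _)) as (s1 & H1).
    exists (s1 + s2). intros t Ht.
    specialize (H1 t ltac:(lia)). specialize (H2 t ltac:(lia)). lia.
Qed.

Lemma safe_survivor s p :
  (forall t, s <= t -> p < e t) -> forall t, discard t <> survivor s p.
Proof.
  intros H t E.
  rewrite <- (survivor_fixed s (S t) p H) in E.
  replace (S t + s) with (s + S t) in E by lia.
  destruct (survivor_earlier (S t) s p) as (q & Hq).
  rewrite Hq in E. symmetry in E. exact (survivor_succ_neq _ _ E).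
Qed.

Lemma onto_recurrent : (forall y, exists s, discard s = y) -> recurrent 0.
Proof.
  intros H. apply NNPP. intros Hno.
  destruct (not_recurrent_below 0) as (s & Hs).
  { intros k Hk. now replace k with 0 by lia. }
  destruct (H (survivor s 0)) as (t & Ht).
  exact (safe_survivor s 0 Hs t Ht).
Qed.

Lemma onto_from_recurrent N :
  (forall y, N <= y -> exists s, discard s = y) -> exists k, recurrent k.
Proof.
  intros H. apply NNPP. intros Hno.
  destruct (not_recurrent_below N) as (s & Hs); [intros k _ Hk; eauto|].
  (* The ranks up to [N] belong to [N + 1] elements below [N]. *)
  assert (Hlen : length (map (survivor s) (seq 0 (S N))) <= length (seq 0 N)).
  { apply NoDup_incl_length.
    - apply Injective_map_NoDup; [apply survivor_inj | apply seq_NoDup].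
    - intros y Hy. apply in_map_iff in Hy as (p & <- & Hp).
      apply in_seq in Hp. apply in_seq.
      destruct (le_lt_dec N (survivor s p)) as [L|L]; [|lia].
      destruct (H _ L) as (t & Ht). exfalso.
      apply (safe_survivor s p) in Ht; [easy|].
      intros u Hu. specialize (Hs u Hu). lia. }
  rewrite length_map, !length_seq in Hlen. lia.
Qed.

(** [survivor] changes its second argument along the recursion; accumulating
    that argument instead makes it an instance of primitive recursion. *)
Lemma survivor_rec s p :
  survivor s p =
  nat_rect (fun _ => nat) p
    (fun m r => if r <? e (s - S m) then r else S r) s.
Proof.
  set (W := nat_rect (fun _ => nat) p
              (fun m r => if r <? e (s - S m) then r else S r)).
  assert (H : forall m, m <= s -> survivor s p = survivor (s - m) (W m)).
  { induction m as [|m IH]; intros Hm; [now rewrite Nat.sub_0_r|].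
    rewrite IH by lia. replace (s - m) with (S (s - S m)) by lia.
    reflexivity. }
  rewrite (H s), Nat.sub_diag; reflexivity.
Qed.
End Survivors.

(** * Hardness *)

(** Hard-wiring the first argument as a constant; the number of the resulting
    code depends on it by a primitive recursion. *)
Lemma smn F :
  computable F ->
  exists h, computable h /\ forall i x, phi (h i) x (F <<i, x>>).
Proof.
  intros HF. apply computable_iff in HF as (c & Hc).
  exists (fun i => encode (Comp c (Pair (const_code i) (Pair Fst Snd)))). split.
  - assert (Hconst : computable (fun i => encode (const_code i))).
    { apply (computable_ext (fun i => nat_rect (fun _ => nat) 0
        (fun _ r => S (S (S (S (S (<<1, r>> + (<<1, r>> + (<<1, r>> + (<<1, r>> + 0))))))))) i)).
      - apply (computable_rec (fun _ => 0)
          (fun _ _ r => S (S (S (S (S (<<1, r>> + (<<1, r>> + (<<1, r>> + (<<1, r>> + 0)))))))))); comp.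
      - intros i. induction i as [|i IH]; [reflexivity|]. simpl. now rewrite IH. }
    cbn [encode Nat.mul Nat.add]. comp.
  - intros i x. apply phi_encode. simpl. exists <<i, x>>. split; [|apply Hc].
    exists i, x. split; [apply eval_const_code|]. split; [|reflexivity].
    eexists _, _. repeat split. now rewrite pair_eta.
Qed.

(** Stated for an arbitrary computable family of sequences because the two
    reductions differ only in the choice of [E]. *)
Lemma discard_reduction (E : nat -> nat -> nat) :
  computable (fun z => E (lft z) (rgt z)) ->
  exists h, computable h /\ (forall i, INJ (h i)) /\
    (forall i, UHI (h i) <-> recurrent (E i) 0) /\
    (forall i, WUI (h i) <-> exists k, recurrent (E i) k).
Proof.
  intros HE.
  destruct (smn (fun z => discard (E (lft z)) (rgt z))) as (h & Hh & Hphi).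
  { apply (computable_ext (fun z => nat_rect (fun _ => nat) (E (lft z) (rgt z))
      (fun m r => if r <? E (lft z) (rgt z - S m) then r else S r) (rgt z))).
    - apply (computable_rec _ (fun z m r =>
        if r <? E (lft z) (rgt z - S m) then r else S r)); comp.
      apply (computable_app2 E); comp.
    - intros z. symmetry. apply survivor_rec. }
  exists h. split; [exact Hh|].
  assert (Hinj : forall i, injection_structure (h i) (discard (E i))).
  { intros i. split; [|apply discard_inj]. intros x.
    specialize (Hphi i x). revert Hphi. now unpair. }
  assert (Hf : forall i f, injection_structure (h i) f ->
                 forall x, f x = discard (E i) x).
  { intros i f (H & _) x.
    apply (phi_functional (h i) x); [apply H | apply Hinj]. }
  split; [|split]; intros i.
  - now exists (discard (E i)).
  - rewrite UHI_iff. split.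
    + intros (f & H & Hon). apply onto_recurrent. intros y.
      destruct (Hon y) as (x & Hx); [lia|]. exists x.
      now rewrite <- (Hf i f H).
    + intros Hr. exists (discard (E i)). split; [apply Hinj|].
      intros y _. now apply discard_onto.
  - rewrite WUI_iff. split.
    + intros (N & f & H & Hon). apply (onto_from_recurrent _ N). intros y Hy.
      destruct (Hon y Hy) as (x & Hx). exists x. now rewrite <- (Hf i f H).
    + intros (k & Hk). destruct (discard_onto_from _ k Hk) as (N & HN).
      exists N, (discard (E i)). split; [apply Hinj | exact HN].
Qed.

Lemma UHI_hard A :
  Pi0 2 A ->
  exists f, computable f /\ (forall i, INJ (f i)) /\ forall i, A i <-> UHI (f i).
Proof.
  intros HA. apply Pi02_recurrent in HA as (ev & Hev & HA).
  destruct (discard_reduction (fun i s => if ev i s then 0 else 1))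
    as (h & Hh & Hinj & HU & _); [comp|].
  exists h. split; [exact Hh|]. split; [exact Hinj|]. intros i.
  rewrite HU, HA. unfold recurrent.
  split; intros H s; destruct (H s) as (t & Ht & E); exists t;
    (split; [exact Ht|]); now destruct (ev i t).
Qed.

Lemma WUI_hard A :
  Sigma0 3 A ->
  exists f, computable f /\ (forall i, INJ (f i)) /\ forall i, A i <-> WUI (f i).
Proof.
  intros (B & HB & HA). apply Pi02_recurrent in HB as (ev & Hev & HB).
  (* At stage [<<x, t>>] the [t]-th event for the candidate [x] is polled; the
     stage itself serves as a value that cannot recur. *)
  destruct (discard_reduction
    (fun i s => if ev <<i, lft s>> (rgt s) then lft s else s))
    as (h & Hh & Hinj & _ & HW).
  { comp. apply (computable_app2 (fun u v => Nat.b2n (ev u v))); [exact Hev|comp|comp]. }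
  exists h. split; [exact Hh|]. split; [exact Hinj|]. intros i.
  rewrite HW, HA. unfold recurrent.
  split; intros (k & Hk); exists k.
  - rewrite HB in Hk. intros s. destruct (Hk s) as (t & Ht & E).
    exists <<k, t>>. unpair. rewrite E. split; [|reflexivity].
    pose proof (Cantor.to_nat_non_decreasing k t). lia.
  - apply HB. intros t0.
    (* Late enough, the stage exceeds [k] and all pairs [<<k, t>>], [t < t0]. *)
    assert (Hbound : exists b, k < b /\ forall t, t < t0 -> <<k, t>> < b).
    { clear. induction t0 as [|t0 (b & Hb & IH)].
      - exists (S k). split; [lia | intros; lia].
      - exists (b + S <<k, t0>>). split; [lia|]. intros t Ht.
        destruct (Nat.eq_dec t t0) as [->|]; [lia|].
        specialize (IH t ltac:(lia)). lia. }
    destruct Hbound as (b & Hb & Hlt). destruct (Hk b) as (s & Hs & E).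
    destruct (ev <<i, lft s>> (rgt s)) eqn:Eev; [|lia].
    rewrite E in Eev. exists (rgt s). split; [|exact Eev].
    destruct (le_lt_dec t0 (rgt s)) as [L|L]; [exact L|].
    specialize (Hlt _ L). rewrite <- E, pair_eta in Hlt. lia.
Qed.

Lemma complete_of_hard (Gamma : (nat -> Prop) -> Prop) (B C : nat -> Prop) :
  Gamma B -> (forall n, B n -> C n) ->
  (forall A, Gamma A -> exists f, computable f /\ (forall i, C (f i)) /\
     forall i, A i <-> B (f i)) ->
  complete Gamma B /\ complete_relative Gamma B C.
Proof.
  intros HB HBC Hhard. split; split; auto.
  - intros A HA. destruct (Hhard A HA) as (f & Hf & _ & H). eauto.
  - exists B. split; [exact HB|]. firstorder.
Qed.

Theorem theorem5p8 :
  (complete (Pi0 2) UHI /\ complete_relative (Pi0 2) UHI INJ) /\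
  (complete (Sigma0 3) WUI /\ complete_relative (Sigma0 3) WUI INJ).
Proof.
  split; apply complete_of_hard.
  - exact UHI_Pi02.
  - intros n (f & Hf & _). now exists f.
  - exact UHI_hard.
  - exact WUI_Sigma03.
  - intros n (f & Hf & _). now exists f.
  - exact WUI_hard.
Qed.
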